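(* Let $P$ be a minimization problem which can be modeled as a finite lazy task system, let $c\geq1$ be a constant and let $\mathrm{ALG}$ be a deterministic $c$-competitive $P$-algorithm with advice complexity $o(n)$. Then for every $\varepsilon>0$ there exists a randomized $(c+\varepsilon)$-competitive $P$-algorithm without advice.
   Context: A lazy task system $(\mathcal{S},\mathcal{T},d)$: states $\mathcal{S}$, tasks $\mathcal{T}$ (each task $t:\mathcal{S}\to\mathbb{R}_{\ge0}\cup\{\infty\}$ with some state of finite value), and $d:\mathcal{S}\times\mathcal{S}\to\mathbb{R}_{\ge0}$ with $d(s,s')>0$ for $s\ne s'$ and satisfying the triangle inequality. Input: initial state $s_0$ and tasks $t_1,\dots,t_n$; an online algorithm chooses $s_i$ from $s_0,t_1,\dots,t_i$ with $t_i(s_i)\neq\infty$ and pays $d(s_{i-1},s_i)+t_i(s_i)$; cost is the total. It is finite if $\mathcal{S}$ and $\mathcal{T}$ are finite. Advice is read from an infinite tape prepared by an oracle knowing the input; advice complexity is the maximum number of bits read on inputs of length at most $n$. An algorithm is $c$-competitive if there is a constant $\alpha$ (independent of the input) with (expected) cost at most $c\,\mathrm{OPT}(\sigma)+\alpha$ for all $\sigma$; a randomized algorithm is a probability distribution over deterministic algorithms. *)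

(* Defs.v *)
From HB Require Import structures.
From mathcomp Require Import all_boot all_order all_algebra.
From mathcomp Require Import all_classical all_reals all_analysis measurable_realfun.
Set Implicit Arguments. Unset Strict Implicit. Unset Printing Implicit Defensive.
Import Order.TTheory GRing.Theory Num.Theory.
Local Open Scope classical_set_scope.
Local Open Scope ring_scope.
Local Open Scope ereal_scope.

Section LTS.
(* A finite lazy task system: finite states S, finite task type T with
   evaluation tv (task values in [0, +oo]), and a distance d. *)
Variables (R : realType) (S T : finType) (tv : T -> S -> \bar R)
          (d : S -> S -> R).

Definition lazy_task_system : Prop :=
  [/\ (forall t s, 0 <= tv t s),
      (forall t, exists s, tv t s < +oo),
      (forall s s', (0 <= d s s')%R),
      (forall s s', s != s' -> (0 < d s s')%R) &
      (forall s1 s2 s3, (d s1 s3 <= d s1 s2 + d s2 s3)%R)].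

Fixpoint path_cost (s : S) (ts : seq T) (ss : seq S) : \bar R :=
  match ts, ss with
  | t :: ts', s' :: ss' => (d s s')%:E + tv t s' + path_cost s' ts' ss'
  | _, _ => 0
  end.

Definition OPT (s0 : S) (ts : seq T) : \bar R :=
  ereal_inf [set path_cost s0 ts ss | ss in [set ss : seq S | size ss = size ts]].

(* A s0 [:: t_1; ...; t_i] is the state s_i chosen after seeing t_i. *)
Definition det_alg := S -> seq T -> S.

Definition det_outputs (A : det_alg) (s0 : S) (ts : seq T) : seq S :=
  [seq A s0 (take i ts) | i <- iota 1 (size ts)].

Definition det_cost (A : det_alg) (s0 : S) (ts : seq T) : \bar R :=
  path_cost s0 ts (det_outputs A s0 ts).

Definition det_feasible (A : det_alg) : Prop :=
  forall s0 ts t, tv t (A s0 (rcons ts t)) < +oo.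

Definition randomized_competitive (c : R) : Prop :=
  exists (dsp : measure_display) (Omega : measurableType dsp)
         (P : probability Omega R) (B : Omega -> det_alg),
    [/\ (forall w, det_feasible (B w)),
        (forall s0 ts, measurable_fun [set: Omega] ((fun w => det_cost (B w) s0 ts) : Omega -> \bar R)) &
        exists alpha : R, forall s0 ts,
          \int[P]_w det_cost (B w) s0 ts <= c%:E * OPT s0 ts + alpha%:E].

(* Sequential access to an infinite advice tape phi : nat -> bool.
   While serving task t_i, the algorithm knows s0, t_1..t_i and the bits
   read so far; act returns None = "read the next bit of the tape",
   or Some s = "move to state s" (serve t_i in s). *)
Definition advice_alg := S -> seq T -> seq bool -> option S.

Definition tape_prefix (phi : nat -> bool) (m : nat) : seq bool := mkseq phi m.

Inductive exec (A : advice_alg) (phi : nat -> bool) (s0 : S) :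
    seq T -> seq S -> nat -> Prop :=
| exec_nil : exec A phi s0 [::] [::] 0
| exec_step ts ss b t k s :
    exec A phi s0 ts ss b ->
    (forall j, (j < k)%N -> A s0 (rcons ts t) (tape_prefix phi (b + j)) = None) ->
    A s0 (rcons ts t) (tape_prefix phi (b + k)) = Some s ->
    exec A phi s0 (rcons ts t) (rcons ss s) (b + k).

Definition sublinear (b : nat -> nat) : Prop :=
  forall delta : R, (0 < delta)%R ->
    exists N : nat, forall n : nat, (N <= n)%N -> ((b n)%:R <= delta * n%:R)%R.

(* A is c-competitive with an oracle (knowing the whole input) and its
   advice complexity (max bits read on inputs of length <= n) is o(n). *)
Definition advice_competitive_sublinear (A : advice_alg) (c : R) : Prop :=
  exists (oracle : S -> seq T -> (nat -> bool)) (b : nat -> nat) (alpha : R),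
    sublinear b /\
    forall s0 ts, exists ss k,
      [/\ exec A (oracle s0 ts) s0 ts ss k,
          (k <= b (size ts))%N &
          path_cost s0 ts ss <= c%:E * OPT s0 ts + alpha%:E].

End LTS.

(* Main.v *)
(* Costs are first rounded up to multiples of a small g > 0; as there are only
   finitely many distances and task values, this costs a factor 1 + e and makes
   all costs natural numbers.

   Fix a state o and let the work function of a task sequence be x |-> the
   optimal cost of serving it from o and then travelling to x.  A task is null
   if it does not change the work function.  Non-null tasks raise the sum of the
   work function by at least 1, so their number is O(OPT + 1); this is what
   turns "o(n) advice bits" into "o(OPT) advice bits", even on long inputs with
   a small optimum.  The online algorithm keeps only the non-null tasks, but
   simulates each advice string (an "expert") on a sequence in which every kept
   task is preceded by R0 rounds of all currently null tasks, which leaves the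
   optimum unchanged.  During these rounds the expert either visits a safe state,
   one where all null tasks are free, or pays at least R0.  While real null tasks
   arrive, the algorithm waits in a safe state, so by the triangle inequality it
   pays at most 1 + 1/q times what the expert pays.

   The input is cut into blocks of n0 kept tasks.  In each block the algorithm
   runs multiplicative weights over the 2^b experts, drawing a new expert every
   L kept tasks; the cost of switching and the regret O(b + 1) are a small
   fraction of OPT, which is of order n0.  The pathwise cost is a sum of terms
   each involving a single draw, so only the marginals matter, and one seed (a
   finite family of independent draws indexed by the possible histories) can be
   reused in all blocks.  Hence a finite probability space suffices. *)
Require Import Defs.
From HB Require Import structures.
From mathcomp Require Import all_boot all_order all_algebra.
From mathcomp Require Import all_classical all_reals all_analysis measurable_realfun.
From mathcomp Require Import zify ring lra.
Set Implicit Arguments. Unset Strict Implicit. Unset Printing Implicit Defensive.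
Import Order.TTheory GRing.Theory Num.Theory.

(** * Integer lazy task systems and their work functions *)

Section HistorySums.
Variables (T : Type).

Fixpoint hsum (f : seq T -> T -> nat) (h u : seq T) : nat :=
  if u is t :: u' then f h t + hsum f (rcons h t) u' else 0.

Lemma hsum_cat f h u v : hsum f h (u ++ v) = hsum f h u + hsum f (h ++ u) v.
Proof.
elim: u h => [|t u IH] h /=; first by rewrite cats0.
by rewrite IH addnA cat_rcons.
Qed.

Lemma hsum_rcons f h u t : hsum f h (rcons u t) = hsum f h u + f (h ++ u) t.
Proof. by rewrite -cats1 hsum_cat /= addn0. Qed.

Lemma hsum_le f h u B : (forall h t, f h t <= B) -> hsum f h u <= size u * B.
Proof.
move=> fB; elim: u h => [|t u IH] h //=.
by rewrite mulSn leq_add.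
Qed.

End HistorySums.

(* Lazy task systems with integer costs; [nfeas t s] is [tv t s < +oo], and
   [ntask t s] is irrelevant when [nfeas t s] fails. *)
Record nat_lts (S T : finType) := NatLTS {
  ndist : S -> S -> nat;
  ntask : T -> S -> nat;
  nfeas : T -> S -> bool;
  nfeas_ex : forall t, exists s, nfeas t s;
  ndist_tri : forall x y z, ndist x z <= ndist x y + ndist y z;
  ndist_gt0 : forall x y, x != y -> 0 < ndist x y }.

Section WorkFunction.
Variables (S T : finType) (M : nat_lts S T) (o : S).
Local Notation d := (ndist M).
Local Notation c := (ntask M).
Local Notation ok := (nfeas M).
Implicit Types (a : {ffun S -> nat}) (t : T) (x y s : S) (ts k : seq T).

Definition some_feas t : S := xchoose (nfeas_ex M t).

Lemma some_feasP t : ok t (some_feas t).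
Proof. exact: xchooseP. Qed.

(* Arrival form of the work function: the value at [x] is the optimal cost of
   serving the tasks so far and then travelling to [x]. *)
Definition upd a t : {ffun S -> nat} :=
  [ffun x => let y := [arg min_(y < some_feas t | ok t y) (a y + c t y + d y x)]
             in a y + c t y + d y x].

Definition work ts : {ffun S -> nat} := foldl upd [ffun x => d o x] ts.

(** [d] need be neither symmetric nor zero on the diagonal, so the direction of travel matters. *)
Definition lipschitz a := forall x y, a y <= a x + d x y.

Lemma upd_le a t x y : ok t y -> upd a t x <= a y + c t y + d y x.
Proof.
move=> oky; rewrite ffunE /=.
by case: (arg_minnP _ (some_feasP t)) => i _ /(_ y oky).
Qed.

Lemma upd_att a t x : exists2 y, ok t y & upd a t x = a y + c t y + d y x.
Proof.
by rewrite ffunE /=; case: (arg_minnP _ (some_feasP t)) => i oki _; exists i.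
Qed.

Lemma lipschitz_upd a t : lipschitz (upd a t).
Proof.
move=> x y; have [z okz ->] := upd_att a t x.
by have := upd_le a y okz; have := ndist_tri M z x y; lia.
Qed.

Lemma upd_ge a t x : lipschitz a -> a x <= upd a t x.
Proof.
by move=> la; have [z okz ->] := upd_att a t x; have := la z x; lia.
Qed.

Lemma lipschitz_foldl a ts : lipschitz a -> lipschitz (foldl upd a ts).
Proof. by elim: ts a => //= t ts IH a la; apply/IH/lipschitz_upd. Qed.

Lemma lipschitz_work ts : lipschitz (work ts).
Proof.
by apply: lipschitz_foldl => x y; rewrite !ffunE; apply: ndist_tri.
Qed.

Lemma work_rcons ts t : work (rcons ts t) = upd (work ts) t.
Proof. by rewrite /work foldl_rcons. Qed.

Lemma work_cat ts ts' : work (ts ++ ts') = foldl upd (work ts) ts'.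
Proof. by rewrite /work foldl_cat. Qed.

Definition null a t := upd a t == a.

Fixpoint nonnull_from a k :=
  if k is t :: k' then ~~ null a t && nonnull_from (upd a t) k' else true.

Lemma nonnull_from_rcons a k t :
  nonnull_from a (rcons k t) = nonnull_from a k && ~~ null (foldl upd a k) t.
Proof. by elim: k a => [|u k IH] a /=; rewrite ?andbT // IH andbA. Qed.

Definition nonnull k := nonnull_from [ffun x => d o x] k.

Lemma nonnull_rcons k t :
  nonnull (rcons k t) = nonnull k && ~~ null (work k) t.
Proof. exact: nonnull_from_rcons. Qed.

(** Work functions grow pointwise and are integer-valued, so every non-null task raises their sum by
    at least 1. *)
Lemma size_nonnull k : nonnull k -> size k <= \sum_x work k x.
Proof.
elim/last_ind: k => [|k t IH] //; rewrite nonnull_rcons => /andP[/IH kle nn].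
rewrite size_rcons work_rcons.
have le x : work k x <= upd (work k) t x by apply/upd_ge/lipschitz_work.
apply: leq_ltn_trans kle _.
have [x nx] : exists x, upd (work k) t x != work k x.
  apply/existsP; apply: contraR nn; rewrite negb_exists => /forallP H.
  by apply/eqP/ffunP => x; apply/eqP; rewrite -[_ == _]negbK H.
rewrite (bigD1 x) //= [X in _ < X](bigD1 x) //= -addSn leq_add //.
  by rewrite ltn_neqAle eq_sym nx le.
by apply: leq_sum => y _; apply: le.
Qed.

Lemma size_nonnull_le D k x : (forall x y, d x y <= D) ->
  nonnull k -> size k <= #|S| * (work k x + D).
Proof.
move=> dD /size_nonnull /leq_trans; apply.
rewrite -sum_nat_const; apply: leq_sum => y _.
by apply: leq_trans (lipschitz_work k x y) _; rewrite leq_add2l.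
Qed.

Fixpoint npath (s : S) ts (ss : seq S) : nat :=
  match ts, ss with
  | t :: ts', s' :: ss' => d s s' + c t s' + npath s' ts' ss'
  | _, _ => 0
  end.

Lemma npath_rcons s ts ss t s' : size ss = size ts ->
  npath s (rcons ts t) (rcons ss s') =
  npath s ts ss + d (last s ss) s' + c t s'.
Proof.
elim: ts s ss => [|u ts IH] s [|x ss] //=; first by rewrite addn0 add0n.
by case=> /IH ->; lia.
Qed.

(* [all2] also forces equal sizes. *)
Definition npath_ok ts (ss : seq S) := all2 ok ts ss.

Lemma npath_ok_size ts ss : npath_ok ts ss -> size ss = size ts.
Proof. by rewrite /npath_ok all2E => /andP[/eqP ->]. Qed.

Lemma npath_ok_rcons ts ss t s :
  size ss = size ts ->
  npath_ok (rcons ts t) (rcons ss s) = npath_ok ts ss && ok t s.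
Proof.
rewrite /npath_ok; elim: ts ss => [|u ts IH] [|x ss] //=.
  by rewrite andbT.
by case=> /IH ->; rewrite andbA.
Qed.

Lemma work_attained ts x : exists2 ss, npath_ok ts ss &
  npath o ts ss + d (last o ss) x = work ts x.
Proof.
elim/last_ind: ts x => [|ts t IH] x; first by exists [::]; rewrite ?ffunE.
rewrite work_rcons; have [y oky ->] := upd_att (work ts) t x.
have [ss okss <-] := IH y; exists (rcons ss y).
  by rewrite npath_ok_rcons ?okss //; apply: npath_ok_size.
by rewrite npath_rcons ?(npath_ok_size okss) // last_rcons; lia.
Qed.

Definition cheapest a : S := [arg min_(x < o) a x].

(** The condition on [d s s] is there because staying put is charged [d s s]. *)
Definition safe a s :=
  [forall t, null a t ==> [&& ok t s, d s s == 0 & c t s == 0]].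

Lemma safeP a s t : safe a s -> null a t ->
  [/\ ok t s, d s s = 0 & c t s = 0].
Proof.
by move=> /forallP /(_ t) /implyP H /H /and3P[? /eqP ? /eqP ?].
Qed.

(** If [t] is null, the minimum at [s] equals [a y + c t y + d y s] for a feasible [y]. As
    [a s <= a y], the last two terms vanish, and [d y s = 0] forces [y = s]. *)
Lemma safe_cheapest a : safe a (cheapest a).
Proof.
apply/forallP => t; apply/implyP => /eqP na.
rewrite /cheapest; case: (@arg_minnP _ o xpredT a isT) => s _ smin.
have [y oky] := upd_att a t s; rewrite na => e.
have := smin y isT; case: (eqVneq y s) e oky => [->|/(ndist_gt0 M)]; last lia.
by move=> e -> _; apply/andP; split; lia.
Qed.

End WorkFunction.

(** * Following an expert *)

Section OnlineCost.
Variables (S T : finType) (M : nat_lts S T).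
Local Notation d := (ndist M).
Local Notation c := (ntask M).
Local Notation ok := (nfeas M).
Implicit Types (E : seq T -> S) (h u : seq T) (t : T).

Definition online E := forall h t, ok t (E (rcons h t)).

Definition ecost E := hsum (fun h t => d (E h) (E (rcons h t)) + c t (E (rcons h t))).

Lemma ecost_npath E h u :
  ecost E h u = npath M (E h) u [seq E (h ++ take i u) | i <- iota 1 (size u)].
Proof.
elim: u h => [|t u IH] h //; rewrite /ecost /= -/(ecost E) IH take0 cats1.
congr (_ + npath _ _ _ _); rewrite (iotaDl 1 1) -map_comp.
by apply: eq_map => i /=; rewrite cat_rcons.
Qed.

Lemma online_npath_ok E h u : online E ->
  npath_ok M u [seq E (h ++ take i u) | i <- iota 1 (size u)].
Proof.
move=> onE; elim: u h => [|t u IH] h //=; rewrite take0 cats1 onE /=.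
have := IH (rcons h t); congr (npath_ok _ _ _).
rewrite (iotaDl 1 1) -map_comp.
by apply: eq_map => i /=; rewrite cat_rcons.
Qed.

Lemma dist_ecost E h u y : d (E h) y <= ecost E h u + d (E (h ++ u)) y.
Proof.
elim: u h => [|t u IH] h /=; first by rewrite cats0.
rewrite /ecost /= -/(ecost E); have := IH (rcons h t).
by have := ndist_tri M (E h) (E (rcons h t)) y; rewrite cat_rcons; lia.
Qed.

(** Distinct states are at positive distance, so at cost 0 the expert never leaves [E h]. *)
Lemma ecost_eq0 E h u t : online E -> ecost E h u = 0 -> t \in u ->
  [/\ ok t (E h), d (E h) (E h) = 0 & c t (E h) = 0].
Proof.
move=> onE; elim: u h => [|v u IH] h //; rewrite /ecost /= -/(ecost E) inE.
move=> e; have {e} [d0 c0 e0] : [/\ d (E h) (E (rcons h v)) = 0,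
  c v (E (rcons h v)) = 0 & ecost E (rcons h v) u = 0] by split; lia.
have Eh : E (rcons h v) = E h.
  by apply/esym/eqP/contraT => /(ndist_gt0 M); rewrite d0.
move: d0 c0 (onE h v); rewrite Eh => d0 c0 okv.
case/predU1P => [->|tu]; first by split.
by rewrite -Eh; apply: IH.
Qed.

Lemma ecost_le E h u B : (forall x y, d x y <= B) -> (forall t s, c t s <= B) ->
  ecost E h u <= size u * (2 * B).
Proof. by move=> dB cB; apply: hsum_le => {}h t; rewrite mul2n -addnn leq_add. Qed.

End OnlineCost.

(** * The online wrapper and its pathwise cost *)

Section Wrapper.
Variables (S T : finType) (M : nat_lts S T) (o : S).
Variables (D q R0 L n0 : nat).
Hypothesis dD : forall x y, ndist M x y <= D.
(** Makes a detour of two moves, at most [2 * D], cost at most a fraction [1/q] of an expert's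
    payment of [R0]. *)
Hypothesis R0D : 2 * D * q <= R0.
Hypotheses (L_gt0 : 0 < L) (n0_gt0 : 0 < n0).
Local Notation d := (ndist M).
Local Notation c := (ntask M).
Local Notation ok := (nfeas M).
Local Notation upd := (upd M).
Local Notation work := (work M o).
Implicit Types (E : seq T -> S) (h u k : seq T) (t : T) (a : {ffun S -> nat}).

(* Null tasks leave the work function, hence the optimum, unchanged: one may
   hammer an expert with them until it either sits in a safe state or has paid
   so much that a detour through another state is comparatively free. *)
Definition cyc a := enum [pred t | null M a t].
Definition hammer a := flatten (nseq R0 (cyc a)).

Fixpoint fed_from a k : seq T :=
  if k is t :: k' then hammer a ++ t :: fed_from (upd a t) k' else [::].
Definition fed := fed_from [ffun x => d o x].

Lemma fed_rcons k t : fed (rcons k t) = fed k ++ rcons (hammer (work k)) t.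
Proof.
rewrite /fed; have -> : work k = foldl upd [ffun x => d o x] k by [].
elim: k [ffun x => d o x] => [|u k IH] a /=.
  by rewrite -cats1.
by rewrite IH -catA.
Qed.

Lemma foldl_hammer a : foldl upd a (hammer a) = a.
Proof.
rewrite /hammer; elim: R0 => //= r IH; rewrite foldl_cat.
suff -> : foldl upd a (cyc a) = a by [].
have: all (null M a) (cyc a) by apply/allP => t; rewrite mem_enum.
by elim: (cyc a) => //= t u IHu /andP[/eqP -> /IHu].
Qed.

Lemma work_fed k : work (fed k) = work k.
Proof.
elim/last_ind: k => [|k t IH] //.
rewrite fed_rcons work_cat IH.
by rewrite foldl_rcons foldl_hammer work_rcons.
Qed.

Lemma size_hammer a : size (hammer a) <= R0 * #|T|.
Proof.
rewrite /hammer size_flatten /shape map_nseq sumn_nseq mulnC leq_mul2l.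
by rewrite -cardE max_card orbT.
Qed.

Lemma size_fed k : size (fed k) <= size k * (R0 * #|T|).+1.
Proof.
elim/last_ind: k => [|k t IH] //; rewrite fed_rcons size_cat !size_rcons mulSnr.
by rewrite leq_add // ltnS size_hammer.
Qed.

Lemma fed_cat k u : exists2 v, fed (k ++ u) = fed k ++ v &
  size v <= size u * (R0 * #|T|).+1.
Proof.
elim/last_ind: u => [|u t [v vE sv]]; first by exists [::]; rewrite ?cats0.
exists (v ++ rcons (hammer (work (k ++ u))) t).
  by rewrite -rcons_cat fed_rcons vE catA.
rewrite size_cat !size_rcons mulSnr leq_add // ltnS size_hammer //.
Qed.

(** A round of cost 0 serves all null tasks for free in one state, which is then safe. Hence each of
    the [R0] rounds costs at least 1. *)
Lemma hammer_unsafe E a h : online M E ->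
    (forall r, r <= size (hammer a) -> ~~ safe M a (E (h ++ take r (hammer a)))) ->
  R0 <= ecost M E h (hammer a).
Proof.
move=> onE; rewrite /hammer; elim: R0 h => [|r IH] h //= unsafe.
rewrite /ecost hsum_cat -/(ecost M E) -[r.+1]add1n leq_add //; last first.
  apply: IH => i ile; have := unsafe (size (cyc a) + i).
  by rewrite size_cat leq_add2l ile takeD drop_size_cat // take_size_cat // catA; apply.
rewrite lt0n; apply/eqP => e0; have := unsafe 0 isT; rewrite take0 cats0.
case/negP; apply/forallP => t; apply/implyP => nt.
have [|-> -> ->] // := ecost_eq0 (t := t) onE e0.
by rewrite mem_enum.
Qed.

(** Computable online: the hammer following [k] depends on [k] alone, not on the next kept task. *)
Definition hold E k : S :=
  let a := work k in
  if [pick r : 'I_(size (hammer a)).+1 | safe M a (E (fed k ++ take r (hammer a)))]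
  is Some r then E (fed k ++ take r (hammer a)) else cheapest o a.

Lemma safe_hold E k : safe M (work k) (hold E k).
Proof. by rewrite /hold; case: pickP => // _; apply: safe_cheapest. Qed.

Lemma direct_cost E k t (y := E (fed (rcons k t))) :
  d (E (fed k)) y + c t y <= ecost M E (fed k) (rcons (hammer (work k)) t).
Proof.
rewrite /ecost hsum_rcons -/(ecost M E) /y fed_rcons -!rcons_cat.
have := dist_ecost M E (fed k) (hammer (work k))
  (E (rcons (fed k ++ hammer (work k)) t)).
by lia.
Qed.

(** Either the waiting state lies on the expert's own route, and the triangle inequality suffices,
    or the expert has paid at least [R0], which covers the detour. *)
Lemma hold_cost E k (u t : T) (y := E (fed (rcons k t))) :
    online M E -> null M (work k) u ->
  q * (d (E (fed k)) (hold E k) + d (hold E k) y + c t y)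
    <= q.+1 * ecost M E (fed k) (rcons (hammer (work k)) t).
Proof.
(* The null task [u] makes safety yield [d H H = 0] at the waiting state [H]; this removes the last
   leg in [dist_ecost]. *)
move=> onE nu; have [_ dH0 _] := safeP (safe_hold E k) nu.
have H1 := dist_ecost M E (fed k); move: dH0.
rewrite /hold; case: pickP => [r _ dH|unsafe _].
  rewrite leq_mul //; move: {H1} (H1 (take r (hammer (work k)))).
  rewrite /y fed_rcons -rcons_cat /ecost hsum_rcons -/(ecost M E).
  set w := hammer _; set z := E (rcons _ _) => /(_ (E (fed k ++ take r w))).
  have := dist_ecost M E (fed k ++ take r w) (drop r w) z.
  have: ecost M E (fed k) w = ecost M E (fed k) (take r w) +
          ecost M E (fed k ++ take r w) (drop r w).
    by rewrite -[in LHS](cat_take_drop r w) /ecost hsum_cat.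
  rewrite -catA cat_take_drop -/z; move: dH; rewrite -/w; lia.
have le_ham : R0 <= ecost M E (fed k) (hammer (work k)).
  apply: hammer_unsafe => // r rle.
  by have := unsafe (Ordinal (rle : r < (size (hammer (work k))).+1)) => /= ->.
move: {H1} le_ham (direct_cost E k t); rewrite -/y.
have : ecost M E (fed k) (hammer (work k)) <=
    ecost M E (fed k) (rcons (hammer (work k)) t).
  by rewrite /ecost hsum_rcons leq_addr.
set e := ecost _ _ _ (rcons _ _); set H := cheapest _ _ => le1 le2 le3.
have := dD (E (fed k)) H; have := dD H y => le4 le5.
apply: (@leq_trans (q * (2 * D) + q * e)); last by lia.
by rewrite -mulnDr leq_mul2l; apply/orP; right; lia.
Qed.

(* [w] maps a kept history to the expert that is in charge after it; the expert
   is reconsidered only every [L] kept tasks. *)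
Implicit Types (w : seq T -> seq T -> S).
Definition key k := take (size k %/ L * L) k.

(** [bs] collects the finished blocks and [k] the kept tasks of the current one; nullity is judged
    from a work function restarted at [o] in each block. *)
Definition step (st : seq (seq T) * seq T) t :=
  let: (bs, k) := st in
  if null M (work k) t then (bs, k) else
  let k' := rcons k t in if size k' == n0 then (rcons bs k', [::]) else (bs, k').

Definition run := foldl step ([::], [::]).

Lemma run_rcons ts t : run (rcons ts t) = step (run ts) t.
Proof. by rewrite /run foldl_rcons. Qed.

Definition answer w h t : S :=
  let k := (run h).2 in
  if null M (work k) t then hold (w (key k)) k
  else w (key k) (fed (rcons k t)).

Definition wrapper s0 w h : S :=
  if h is t0 :: _ then answer w (take (size h).-1 h) (last t0 h) else s0.

Lemma wrapper_rcons s0 w h t : wrapper s0 w (rcons h t) = answer w h t.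
Proof.
rewrite /wrapper; case E: (rcons h t) => [|t0 h0]; first by case: h E.
have -> : last t0 (t0 :: h0) = t by rewrite -E last_rcons.
by rewrite -E size_rcons /= -cats1 take_size_cat.
Qed.

Lemma wrapper_online s0 w : (forall h, online M (w h)) ->
  online M (wrapper s0 w).
Proof.
move=> onw h t; rewrite wrapper_rcons /answer; case: ifP => nt.
  by have [] := safeP (safe_hold (w (key (run h).2)) (run h).2) nt.
by rewrite fed_rcons -rcons_cat; apply: (onw (key (run h).2)).
Qed.

(** A budget for [q] times the wrapper's cost within a block, scaled to stay integral. The term
    [q * D] pays for joining a newly drawn expert, also at the start of the block. Each summand
    looks at [w] at a single key. *)
Definition charge w :=
  hsum (fun h t => q.+1 * ecost M (w (key h)) (fed h) (rcons (hammer (work h)) t)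
                   + q * D * (L %| size h)) [::].

Lemma charge_rcons w k t : charge w (rcons k t) = charge w k +
  (q.+1 * ecost M (w (key k)) (fed k) (rcons (hammer (work k)) t)
   + q * D * (L %| size k)).
Proof. by rewrite /charge hsum_rcons. Qed.

Lemma key_rcons k t : ~~ (L %| size (rcons k t)) -> key (rcons k t) = key k.
Proof.
rewrite size_rcons /key size_rcons divnS // => /negPf ->.
by rewrite -cats1 takel_cat // leq_trunc_div.
Qed.

Lemma run_inv ts :
  [/\ all (fun b => nonnull M o b && (size b == n0)) (run ts).1, nonnull M o (run ts).2 &
      size (run ts).2 < n0].
Proof.
elim/last_ind: ts => [|ts t IH] //; rewrite run_rcons.
case: (run ts) IH => bs k /= [nbs nk sk]; case: ifP => [//|/negbT nt].
have nk' : nonnull M o (rcons k t) by rewrite nonnull_rcons nk.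
case: ifP => sk' /=; first by rewrite all_rcons nk' sk' nbs.
by split=> //; rewrite ltn_neqAle sk' size_rcons.
Qed.

Lemma wrapper_cost s0 w ts : (forall h, online M (w h)) ->
  q * ecost M (wrapper s0 w) [::] ts <=
    \sum_(b <- (run ts).1) charge w b + charge w (run ts).2 + 2 * (q * D).
Proof.
move=> onw.
set A := wrapper s0 w.
pose E k := w (key k) (fed k).
(* Invariant: the algorithm is at its expert's state, or a redraw is due and the next charge pays
   the move, or it waits in the [hold] state, having paid in advance for the way there. *)
suff: let: (bs, k) := run ts in let Q := \sum_(b <- bs) charge w b + charge w k in
  (q * ecost M A [::] ts <= Q /\ (L %| size k \/ A ts = E k)) \/
  [/\ exists u : T, null M (work k) u, A ts = hold (w (key k)) k &
     q * ecost M A [::] ts <= Q + q * D * (L %| size k) + q * d (E k) (hold (w (key k)) k)].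
  case: (run ts) => bs k /=; case => [[H _]|[_ _ H]]; first by lia.
  apply: leq_trans H _; have := dD (E k) (hold (w (key k)) k).
  move=> /(leq_mul (leqnn q)); case: (L %| size k); lia.
elim/last_ind: ts => [|ts t IH].
  by left; rewrite /run /= big_nil muln0; split=> //; left; rewrite dvdn0.
rewrite run_rcons /A wrapper_rcons -/A /ecost hsum_rcons -/(ecost M A) /=.
rewrite /A !wrapper_rcons -/A /answer.
case: (run ts) IH => bs k /=; set P := ecost M A [::] ts => IH.
set H := hold _ _ in IH *; set Q := _ + _ in IH.
case: ifP => nt.
  have [_ dH cH] := safeP (safe_hold (w (key k)) k) nt; rewrite -/H in dH cH.
  right; split; first by exists t.
    by [].
  rewrite cH addn0 mulnDr -/Q -/H.
  case: IH => [[le1 [dv|->]]|[_ -> le1]].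
  - by rewrite dv; have := leq_mul (leqnn q) (dD (A ts) H); lia.
  - by rewrite -/(E k); lia.
  - by rewrite dH; lia.
have {IH} key_ineq : q * (P + (d (A ts) (w (key k) (fed (rcons k t)))
    + c t (w (key k) (fed (rcons k t))))) <=
    \sum_(b <- bs) charge w b + charge w (rcons k t).
  rewrite charge_rcons addnA -/Q.
  set y := w _ _; set e := ecost _ _ _ _.
  case: IH => [[le1 alt]|[[u nu] -> le1]]; last first.
    by have := hold_cost t (onw (key k)) nu; rewrite -/H -/y -/e -/(E k); lia.
  have := direct_cost (w (key k)) k t; rewrite -/y -/e -/(E k) => le2.
  have le3 := leq_mul (leqnn q) le2.
  case: alt => [dv|->]; last by lia.
  by rewrite dv; have := leq_mul (leqnn q) (dD (A ts) y); lia.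
case: ifP => full /=; left.
  split; last by left; rewrite dvdn0.
  by rewrite -[rcons bs _]cats1 big_cat big_seq1 [charge w [::]]/charge /= addn0.
split=> //; have [dv|ndv] := boolP (L %| size (rcons k t)); first by left.
by right; rewrite /E key_rcons.
Qed.

(** Null tasks leave the left side unchanged. A completed block costs [2 * D]: one [D] to end it in
    [o], one to restart from [o]; the extra [D] is for starting at [s] instead of [o]. *)
Lemma opt_lower s ts ss x : npath_ok M ts ss ->
  \sum_(b <- (run ts).1) work b o + work (run ts).2 x <=
    npath M s ts ss + d (last s ss) x + D * (2 * size (run ts).1 + 1).
Proof.
clear R0D L_gt0 n0_gt0 q R0 L; move=> okss; have sz := npath_ok_size okss.
elim/last_ind: ts ss x okss sz => [|ts t IH] ss x.
  by move=> _ _; rewrite /run /= big_nil ffunE; have := dD o x; lia.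
case/lastP: ss => [|ss y]; first by rewrite size_rcons.
move=> + sz; move: sz; rewrite !size_rcons => -[sz].
rewrite npath_ok_rcons // => /andP[okss oky].
rewrite run_rcons npath_rcons // last_rcons.
have {IH} := IH ss _ okss sz; case: (run ts) => bs k /= IH.
have upd_x z : \sum_(b <- bs) work b o + upd (work k) t z <=
    npath M s ts ss + d (last s ss) y + c t y + d y z + D * (2 * size bs + 1).
  by have := IH y; have := upd_le (work k) z oky; lia.
case: ifP => [/eqP nt|nt]; first by rewrite -nt.
case: ifP => full /=; last by rewrite work_rcons.
rewrite -[rcons bs _]cats1 big_cat big_seq1 size_cat /= work_rcons.
have: work [::] x <= D by rewrite ffunE.
by have := upd_x o; have := dD y o; lia.
Qed.

End Wrapper.

Local Open Scope ring_scope.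

(** * Multiplicative weights *)

Section ProductSeed.
Variables (R : realType) (H F : finType) (p : H -> F -> R).
Hypothesis p_ge0 : forall h f, 0 <= p h f.
Hypothesis p_sum1 : forall h, \sum_f p h f = 1.

Definition seedp (w : {ffun H -> F}) : R := \prod_h p h (w h).

Lemma seedp_ge0 w : 0 <= seedp w.
Proof. exact: prodr_ge0. Qed.

Lemma seedp_sum1 : \sum_w seedp w = 1.
Proof. by rewrite -bigA_distr_bigA big1. Qed.

(** Distributing the product over the sums, every factor other than [h] sums to 1. *)
Lemma seedp_marginal h (g : F -> R) :
  \sum_w seedp w * g (w h) = \sum_f p h f * g f.
Proof.
pose G h' f := if h' == h then p h' f * g f else p h' f.
transitivity (\sum_(w : {ffun H -> F}) \prod_h' G h' (w h')).
  apply: eq_bigr => w _; rewrite /seedp (bigD1 h) //= [RHS](bigD1 h) //=.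
  rewrite {1}/G eqxx mulrAC; congr (_ * _ * _).
  by apply: eq_bigr => h' /negPf nh; rewrite /G nh.
rewrite -(bigA_distr_bigA G) (bigD1 h) //= /G eqxx [X in _ * X]big1 ?mulr1 //.
by move=> h' /negPf ->.
Qed.

End ProductSeed.

(** [expR (- y) <= 1 / (1 + y)], and [(1 - y + y ^+ 2) * (1 + y) = 1 + y ^+ 3 >= 1]. *)
Lemma expRN_le (R : realType) (y : R) : 0 <= y -> expR (- y) <= 1 - y + y ^+ 2.
Proof.
move=> y0; have y1 : 0 < 1 + y by lra.
have le1 := expR_ge1Dx y.
apply: (@le_trans _ _ (1 + y)^-1).
  by rewrite expRN lef_pV2 ?posrE ?expR_gt0.
by rewrite -[leLHS]mul1r ler_pdivrMr //; nra.
Qed.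

Section Experts.
Variables (R : realType) (S T F : finType) (M : nat_lts S T) (o : S).
Variables (D q R0 L n0 : nat) (E : F -> seq T -> S) (eta C : R).
Local Notation work := (work M o).
Local Notation fed := (fed M o R0).
Local Notation hammer := (hammer M R0).
Local Notation key := (key L).
Implicit Types (k h u : seq T) (t : T) (f : F).

Definition loss f k : R := (ecost M (E f) [::] (fed k))%:R.

Definition weight k f : R := expR (- (eta * loss f k)).
Definition prob k f : R := weight k f / \sum_f' weight k f'.

Variable f0 : F.

Lemma weight_sum_gt0 k : 0 < \sum_f weight k f.
Proof.
by rewrite (bigD1 f0) //= ltr_pwDl ?expR_gt0 // sumr_ge0 // => f _; apply: expR_ge0.
Qed.

Lemma prob_ge0 k f : 0 <= prob k f.
Proof. by rewrite divr_ge0 ?expR_ge0 // ltW // weight_sum_gt0. Qed.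

Lemma prob_sum1 k : \sum_f prob k f = 1.
Proof. by rewrite -mulr_suml mulfV // gt_eqF // weight_sum_gt0. Qed.

(** Keys inside a block have length at most [n0], so a finite index type suffices; the default of
    [insub_bseq] is only met on longer lists. *)
Definition expert (w : {ffun n0.-bseq T -> F}) k := E (w (insub_bseq n0 k)).

Definition echarge k : R :=
  \sum_w seedp (fun h : n0.-bseq T => prob h) w * (charge M o D q R0 L (expert w) k)%:R.

Lemma echarge_rcons k t : (size k <= n0)%N ->
  echarge (rcons k t) = echarge k
    + (q.+1)%:R * (\sum_f prob (key k) f
        * (loss f (rcons k t) - loss f k))
    + (q * D * (L %| size k))%:R.
Proof.
move=> kn0; have keyn0 : (size (key k) <= n0)%N.
  by rewrite size_take_min (leq_trans (geq_minr _ _)).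
have keyE : insub_bseq n0 (key k) = key k :> seq T by rewrite val_insubd keyn0.
have incE f : loss f (rcons k t) - loss f k =
    (ecost M (E f) (fed k) (rcons (hammer (work k)) t))%:R.
  by rewrite /loss fed_rcons /ecost hsum_cat natrD addrAC subrr add0r.
pose P w := seedp (fun h : n0.-bseq T => prob h) w.
transitivity (\sum_w (P w * (charge M o D q R0 L (expert w) k)%:R
    + P w * (q.+1 * ecost M (expert w (key k)) (fed k)
        (rcons (hammer (work k)) t))%:R
    + P w * (q * D * (L %| size k))%:R)).
  by apply: eq_bigr => w _; rewrite charge_rcons addnA !natrD !mulrDr.
rewrite !big_split /= -[X in _ + X]mulr_suml seedp_sum1 ?mul1r; last first.
  by move=> ?; exact: prob_sum1.
congr (_ + _ + _).
pose g f : R := (ecost M (E f) (fed k) (rcons (hammer (work k)) t))%:R.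
transitivity (q.+1%:R * \sum_w P w * g (w (insub_bseq n0 (key k)))).
  by rewrite mulr_sumr; apply: eq_bigr => w _; rewrite natrM mulrCA.
rewrite seedp_marginal; last by move=> ?; exact: prob_sum1.
by congr (_ * _); apply: eq_bigr => f _; rewrite keyE incE.
Qed.

(** All tasks of the chunk share the key [h]: the expected losses telescope, and the redraw fee is
    due only at the first task. *)
Lemma echarge_chunk h u : (L %| size h)%N -> (size u <= L)%N ->
  (size (h ++ u) <= n0)%N ->
  echarge (h ++ u) = echarge h
    + (q.+1)%:R * (\sum_f prob h f
        * (loss f (h ++ u) - loss f h))
    + (q * D * (u != [::]))%:R.
Proof.
move=> Lh; elim/last_ind: u => [|u t IH] uL hun0.
  rewrite cats0 muln0 addr0 big1 ?mulr0 ?addr0 // => f _.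
  by rewrite subrr mulr0.
move: uL hun0; rewrite size_rcons -rcons_cat size_rcons => uL hun0.
have keyh : key (h ++ u) = h.
  rewrite /key size_cat; case/dvdnP: Lh => m hE.
  rewrite hE divnMDl ?(leq_ltn_trans _ uL) // divn_small // addn0 -hE.
  by rewrite take_size_cat.
rewrite echarge_rcons; last exact: ltnW.
rewrite IH; [|exact: ltnW|exact: ltnW].
have -> : (L %| size (h ++ u))%N = (u == [::]).
  rewrite size_cat dvdn_addr //; case: u uL {IH hun0 keyh} => [|a u] uL.
    by rewrite dvdn0.
  by apply/negbTE/negP => /dvdn_leq => /(_ isT); rewrite leqNgt uL.
rewrite keyh; set A := \sum_f _; set B := \sum_f _; set B' := \sum_f _.
have -> : B' = A + B.
  by rewrite /B' -big_split; apply: eq_bigr => f _ /=; ring.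
have -> : rcons u t != [::] by case: (u).
by case: (u == [::]); rewrite /= ?muln0 ?muln1; ring.
Qed.

Hypothesis eta_gt0 : 0 < eta.
Hypothesis etaC_le1 : eta * C <= 1.
Hypothesis dD : forall x y, (ndist M x y <= D)%N.
Hypothesis cD : forall t x, (ntask M t x <= D)%N.
Hypothesis LC : (L * (R0 * #|T|).+1 * (2 * D))%:R <= C.

Lemma loss_cat f h u : (size u <= L)%N ->
  0 <= loss f (h ++ u) - loss f h <= C.
Proof.
move=> uL; have [v vE sv] := fed_cat M o R0 h u.
rewrite /loss vE /ecost hsum_cat natrD addrAC subrr add0r ler0n /=.
apply: le_trans LC; rewrite ler_nat -/(ecost M (E f)).
apply: leq_trans (ecost_le (E f) _ v dD cD) _.
by rewrite leq_mul2r; apply/orP; right; apply: leq_trans sv _; rewrite leq_mul2r uL orbT.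
Qed.

(** With [0 <= x <= C], [expR (- (eta * x)) <= 1 - eta * (1 - eta * C) * x]; average over [prob h],
    then use [1 - z <= expR (- z)]. *)
Lemma weight_sum_cat h u : (size u <= L)%N ->
  \sum_f weight (h ++ u) f <= (\sum_f weight h f) *
    expR (- (eta * (1 - eta * C) * \sum_f prob h f * (loss f (h ++ u) - loss f h))).
Proof.
move=> uL; pose x f := loss f (h ++ u) - loss f h.
have W0 := weight_sum_gt0 h; set W := \sum_f weight h f in W0 *.
have Wp f : weight h f = W * prob h f by rewrite /prob mulrCA mulfV ?mulr1 ?gt_eqF.
apply: (@le_trans _ _ (\sum_f W * (prob h f - eta * (1 - eta * C) * (prob h f * x f)))).
  apply: ler_sum => f _; have /andP[x0 xC] := loss_cat f h uL.
  rewrite -/(x f) in x0 xC.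
  have -> : weight (h ++ u) f = weight h f * expR (- (eta * x f)).
    by rewrite /weight -expRD; congr expR; rewrite /x; ring.
  rewrite Wp -mulrA ler_pM2l //.
  apply: (@le_trans _ _ (prob h f * (1 - eta * x f + (eta * x f) ^+ 2))).
    by rewrite ler_wpM2l ?prob_ge0 // expRN_le // mulr_ge0 // ltW.
  rewrite -subr_ge0; set r := prob h f.
  have -> : r - eta * (1 - eta * C) * (r * x f) - r * (1 - eta * x f + (eta * x f) ^+ 2)
    = eta ^+ 2 * r * x f * (C - x f) by ring.
  by rewrite mulr_ge0 ?subr_ge0 // mulr_ge0 // mulr_ge0 ?sqr_ge0 ?prob_ge0.
rewrite -mulr_sumr ler_pM2l // big_split /= prob_sum1 sumrN -mulr_sumr.
exact: expR_ge1Dx.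
Qed.

(** The left side starts at [#|F|] and does not increase from chunk to chunk: the drop in total
    weight pays for the growth of [echarge] beyond the redraw fees. *)
Lemma potential J h : size h = (J * L)%N -> (size h <= n0)%N ->
  (\sum_f weight h f) *
    expR (eta * (1 - eta * C) / q.+1%:R * (echarge h - (q * D * J)%:R)) <= #|F|%:R.
Proof.
elim: J h => [|J IH] h.
  have e0 : echarge [::] = 0.
    by rewrite /echarge big1 // => w _; rewrite /charge /= mulr0.
  move/size0nil => -> _; rewrite muln0 e0 subr0 mulr0 expR0 mulr1.
  rewrite -sum1_card natr_sum ler_sum // => f _.
  by rewrite /weight /loss [ecost _ _ _ _]/= mulr0 oppr0 expR0.
rewrite mulSn => sh hn0; rewrite -(cat_take_drop (J * L) h).
set h1 := take _ _; set u := drop _ _.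
have sh1 : size h1 = (J * L)%N by rewrite size_take_min sh; apply/minn_idPl; lia.
have su : size u = L by rewrite size_drop sh addnK.
have h1u : h = h1 ++ u by rewrite cat_take_drop.
rewrite echarge_chunk ?su // ?sh1 ?dvdn_mull // -?h1u //.
have {}IH := IH _ sh1 (leq_trans _ hn0).
apply: le_trans (IH _); last by rewrite sh1 sh leq_addl.
have := weight_sum_cat h1 (u := u); rewrite su => /(_ (leqnn _)) wle.
rewrite [in leLHS]h1u; apply: (le_trans (ler_wpM2r (expR_ge0 _) wle)).
rewrite -[leLHS]mulrA -expRD ler_pM2l ?weight_sum_gt0 // ler_expR.
set X := \sum_f _; set P := eta * _; set qq := q.+1%:R.
have qq0 : 0 < qq by rewrite ltr0n.
have P0 : 0 <= P by apply: mulr_ge0; [exact: ltW | rewrite subr_ge0].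
have -> : - (P * X) + P / qq * (echarge h1 + qq * X + (q * D * (u != [::]))%:R
    - (q * D * J.+1)%:R) =
    P / qq * (echarge h1 + (q * D * (u != [::]))%:R - (q * D * J.+1)%:R).
  by field; rewrite gt_eqF.
rewrite ler_wpM2l ?divr_ge0 ?(ltW qq0) //.
rewrite mulnS natrD opprD addrA lerD2r lerBlDr lerD2l ler_nat.
by case: (u != [::]); rewrite ?muln0 ?muln1.
Qed.

(** Regret bound: keep only the weight of [f] in [potential] and take logarithms. *)
Lemma echarge_le J h f : size h = (J * L)%N -> (size h <= n0)%N ->
  (1 - eta * C) * (echarge h - (q * D * J)%:R) <=
    q.+1%:R * (loss f h + ln #|F|%:R / eta).
Proof.
move=> sh hn0; have := potential sh hn0; set X := _ - (q * D * J)%:R => pot.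
have F0 : 0 < #|F|%:R :> R by rewrite ltr0n; apply/card_gt0P; exists f0.
have wle : weight h f <= \sum_f weight h f.
  by rewrite [leRHS](bigD1 f) //= lerDl sumr_ge0 // => g _; apply: expR_ge0.
have {wle} pot' := le_trans (ler_wpM2r (expR_ge0 _) wle) pot.
have := pot'; rewrite -expRD -[leRHS]lnK ?posrE // ler_expR => {}pot.
have q0 : 0 < q.+1%:R :> R by rewrite ltr0n.
rewrite -(ler_pM2l (divr_gt0 eta_gt0 q0)).
have -> : eta / q.+1%:R * ((1 - eta * C) * X) = eta * (1 - eta * C) / q.+1%:R * X by ring.
have -> : eta / q.+1%:R * (q.+1%:R * (loss f h + ln #|F|%:R / eta)) =
  eta * loss f h + ln #|F|%:R by field; rewrite !gt_eqF.
by rewrite -lerBlDl [leLHS]addrC.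
Qed.

End Experts.

(** * The randomized algorithm for integer costs *)

Section Assembly.
Variables (R : realType) (S T : finType) (M : nat_lts S T) (o : S).

Lemma cost_bound : exists D : nat, [/\ (0 < D)%N,
  forall x y, (ndist M x y <= D)%N & forall t x, (ntask M t x <= D)%N].
Proof.
set m1 := \max_(p : S * S) ndist M p.1 p.2.
set m2 := \max_(p : T * S) ntask M p.1 p.2.
exists (1 + m1 + m2)%N; split=> [|x y|t x]; first by rewrite -addnA.
  have : (ndist M x y <= m1)%N by exact: (@leq_bigmax _ (fun p => _) (x, y)).
  by lia.
have : (ntask M t x <= m2)%N by exact: (@leq_bigmax _ (fun p => _) (t, x)).
by lia.
Qed.

(** [ln #|F|] stands for the number of advice bits; quantifying over all feasible schedules [ss]
    replaces an integer optimum. *)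
Definition sublinear_experts (c alpha : R) : Prop :=
  forall delta : R, 0 < delta -> exists N0 : nat, forall N : nat, (N0 <= N)%N ->
  exists (F : finType) (E : F -> seq T -> S),
  [/\ forall f, online M (E f),
      ln #|F|%:R <= delta * N%:R &
      forall ts, (size ts <= N)%N -> exists f, forall ss, npath_ok M ts ss ->
        (ecost M (E f) [::] ts)%:R <= c * (npath M o ts ss)%:R + alpha].

(** Half of [eps] absorbs the factor [rho]. The other half gives [eps / 2 * v = 3 * u]: one [u] each
    for redraws, regret and additive constants. *)
Lemma block_arith (c eps al rho lam G DJ A D v u : R) :
  0 <= c -> 0 < eps -> rho * c <= c + eps / 2 -> 0 <= rho <= 4 ->
  lam <= c * A + al -> 0 <= al -> 0 <= G -> 0 <= A -> 4 * G <= u -> DJ <= u ->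
  u = eps / 6 * v -> 4 * al + 2 * D * (c + eps) + eps * D / 2 <= u ->
  v <= A + D ->
  DJ + rho * (lam + G) <= (c + eps) * (A - 2 * D).
Proof.
move=> c0 e0 rc /andP[r0 r4] lamle al0 G0 A0 Gu DJu uE alu vle.
have h1 : rho * (lam + G) <= rho * (c * A + al + G).
  by rewrite ler_wpM2l // lerD2r.
have h2 : rho * c * A <= (c + eps / 2) * A by rewrite ler_wpM2r.
have h3 : rho * (al + G) <= 4 * (al + G) by rewrite ler_wpM2r // addr_ge0.
have h4 : eps / 2 * v <= eps / 2 * (A + D) by rewrite ler_wpM2l // divr_ge0 ?ltW.
have h5 : rho * (c * A + al + G) = rho * c * A + rho * (al + G) by ring.
have h6 : eps / 2 * v = 3 * u by rewrite uE; field.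
nra.
Qed.

Lemma natural_bound (x : R) : exists n : nat, x <= n%:R.
Proof.
exists (Num.bound `|x|); apply: le_trans (ler_norm x) _.
by apply/ltW/archi_boundP.
Qed.

Lemma switch_bound (D s eps L J : R) : 0 < s -> 0 < eps -> 0 <= J ->
  6 * D * s / eps <= L -> D * J <= eps / 6 * (J * L / s).
Proof.
move=> s0 e0 J0; rewrite ler_pdivrMr // => H.
have -> : eps / 6 * (J * L / s) = J * (L * eps) / (6 * s) by field; rewrite gt_eqF.
rewrite ler_pdivlMr ?mulr_gt0 //.
have -> : D * J * (6 * s) = J * (6 * D * s) by ring.
exact: ler_wpM2l.
Qed.

Lemma regret_bound (lnF s eps eta B n G : R) : 0 < s -> 0 < B -> 0 < eta ->
  lnF <= eps * eta / (24 * s * B) * (n * B) -> G = lnF / eta ->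
  4 * G <= eps / 6 * (n / s).
Proof.
move=> s0 B0 eta0 H ->.
have -> : eps / 6 * (n / s) = 4 * (eps * eta / (24 * s * B) * (n * B) / eta).
  by field; rewrite !gt_eqF.
by rewrite ler_pM2l // ler_pM2r // invr_gt0.
Qed.

Lemma offset_bound (X s eps J n : R) : 0 < s -> 0 < eps ->
  X * (6 * s / eps) <= J -> J <= n -> X <= eps / 6 * (n / s).
Proof.
move=> s0 e0 H Jn; have {}H := le_trans H Jn.
have -> : eps / 6 * (n / s) = n / (6 * s / eps) by field; rewrite !gt_eqF.
by rewrite ler_pdivlMr // divr_gt0 // mulr_gt0.
Qed.

(** One factor [1 + q^-1] comes from waiting, the other from the learning rate, through
    [1 - (q + 1)^-1 = q / (q + 1)]. *)
Lemma charge_bound (q e y l z : R) : 0 < q ->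
  (1 - (q + 1)^-1) * (e - q * y) <= (q + 1) * l ->
  y + (1 + q^-1) ^+ 2 * l <= z -> e <= q * z.
Proof.
move=> q0 H1 H2; have q1 : 0 < q + 1 by rewrite addr_gt0.
apply: le_trans (ler_wpM2l (ltW q0) H2).
rewrite mulrDr addrC -lerBlDr.
have -> : q * ((1 + q^-1) ^+ 2 * l) = (q + 1) / q * ((q + 1) * l).
  by field; rewrite gt_eqF.
have -> : e - q * y = (q + 1) / q * ((1 - (q + 1)^-1) * (e - q * y)).
  by field; rewrite !gt_eqF.
by rewrite ler_wpM2l // divr_ge0 ?ltW.
Qed.

Lemma addn_dist_le (a x D m : nat) : (x <= D)%N ->
  (a + x + D * (2 * m + 1) <= a + 2 * D + D * (2 * m))%N.
Proof. lia. Qed.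

Lemma natrD3 (a b m : nat) : (a + b + m)%:R = a%:R + b%:R + m%:R :> R.
Proof. by rewrite !natrD. Qed.

Theorem nat_randomized (c alpha : R) : 0 <= c -> sublinear_experts c alpha ->
  forall eps : R, 0 < eps ->
  exists (W : finType) (P : W -> R) (A : S -> W -> seq T -> S) (beta : R),
  [/\ forall w, 0 <= P w, \sum_w P w = 1,
      forall s w, online M (A s w) /\ A s w [::] = s &
      forall s ts ss, npath_ok M ts ss ->
        \sum_w P w * (ecost M (A s w) [::] ts)%:R <=
          (c + eps) * (npath M s ts ss)%:R + beta].
Proof.
move=> c0 experts eps e0.
have [D [D0 dD cD]] := cost_bound.
(* [c / q <= eps / 6] gives [(1 + 1 / q) ^+ 2 * c <= c + eps / 2]. *)
have [q0 q0P] := natural_bound (6 * c / eps); pose q := q0.+1.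
have s0 : 0 < #|S|%:R :> R by rewrite ltr0n; apply/card_gt0P; exists o.
pose R0 := (2 * D * q)%N; pose B := (R0 * #|T|).+1.
have [L0 L0P] := natural_bound (6 * D%:R * #|S|%:R / eps); pose L := L0.+1.
pose C : R := (L * B * (2 * D))%:R.
have C0 : 0 < C by rewrite ltr0n !muln_gt0 D0.
pose eta := (q.+1%:R * C)^-1.
have q1 : 0 < q.+1%:R :> R by rewrite ltr0n.
have qp : 0 < q%:R :> R by rewrite ltr0n.
have eta0 : 0 < eta by rewrite invr_gt0 mulr_gt0.
have etaC : eta * C = q.+1%:R^-1 by rewrite /eta invfM -mulrA mulVf ?mulr1 // gt_eqF.
have B0 : 0 < B%:R :> R by rewrite ltr0n.
(* Chosen so that [ln #|F| <= delta * (n0 * B)] makes four times the regret [ln #|F| / eta] at most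
   [eps / 6 * (n0 / #|S|)]. *)
pose delta := eps * eta / (24 * #|S|%:R * B%:R).
have delta0 : 0 < delta.
  apply: divr_gt0; first exact: mulr_gt0.
  by apply: mulr_gt0 => //; apply: mulr_gt0 => //; rewrite ltr0n.
have [N0 /(_ _)experts0] := experts _ delta0.
have [J0 J0P] := natural_bound ((4 * `|alpha| + 2 * D%:R * (c + eps)
  + eps * D%:R / 2) * (6 * #|S|%:R / eps)).
pose J := (J0 + N0).+1; pose n0 := (J * L)%N.
have n0_gt0 : (0 < n0)%N by rewrite muln_gt0.
have n0J : (J <= n0)%N by rewrite leq_pmulr.
(* Fed with a block of [n0] kept tasks, an expert sees at most [n0 * B] tasks. *)
have [|F [E [onE lnF best]]] := experts0 (n0 * B)%N.
  by rewrite (@leq_trans n0) ?leq_pmulr //; lia.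
have [f0 _] := best [::] isT.
pose p := prob M o R0 E eta.
pose P := seedp (fun h : n0.-bseq T => p h).
have p0 h f : 0 <= p h f by apply: prob_ge0.
have p1 (h : n0.-bseq T) : \sum_f p h f = 1 by apply: prob_sum1.
pose ech := echarge M o D q R0 L n0 E eta.
have echE k : \sum_w P w * (charge M o D q R0 L (expert E w) k)%:R = ech k by [].
have etaC1 : eta * C <= 1 by rewrite etaC invf_le1 // ler1n.
pose rho : R := (1 + q%:R^-1) ^+ 2.
have qc : c * q%:R^-1 <= eps / 6.
  rewrite ler_pdivrMr //; have : 6 * c / eps <= q%:R.
    by apply: le_trans q0P _; rewrite ler_nat.
  by rewrite ler_pdivrMr // => h; lra.
pose r : R := q%:R^-1.
have qV : 0 < r <= 1.
  by apply/andP; split; [rewrite invr_gt0 | rewrite invf_le1 // ler1n].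
have rho4 : 0 <= rho <= 4 by rewrite /rho -/r; case/andP: qV => ? ?; apply/andP; split; nra.
have rhoc : rho * c <= c + eps / 2.
  case/andP: qV => r0 r1; have cr0 : 0 <= c * r by rewrite mulr_ge0 // ltW.
  have rcr : r * (c * r) <= c * r by rewrite ler_piMl.
  have -> : rho * c = c + 2 * (c * r) + r * (c * r) by rewrite /rho -/r; ring.
  by move: qc; rewrite -/r; lra.
pose v : R := n0%:R / #|S|%:R; pose u := eps / 6 * v.
(* The [2 * D] subtracted here will cancel the loss per block in [opt_lower]. *)
have block b : nonnull M o b && (size b == n0) ->
    ech b <= q%:R * ((c + eps) * ((work M o b o)%:R - 2 * D%:R)).
  move=> /andP[nb /eqP sb].
  have [|f bestf] := best (fed M o R0 b).
    by rewrite -sb size_fed.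
  have [ss okss ssE] := work_attained M o (fed M o R0 b) o.
  have := bestf _ okss; rewrite -/(loss R M o R0 E f b) => lamle.
  have := @echarge_le R S T F M o D q R0 L n0 E eta C f0 eta0 etaC1 dD cD
    (lexx _) J b f; rewrite sb => /(_ erefl (leqnn _)).
  rewrite -/(ech b) etaC => ineq.
  set A : R := (work M o b o)%:R.
  have lamA : loss R M o R0 E f b <= c * A + `|alpha|.
    apply: le_trans lamle _; rewrite lerD ?ler_norm // ler_wpM2l //.
    by rewrite ler_nat -(work_fed M o R0 b) -ssE leq_addr.
  have lnF0 : 0 <= ln #|F|%:R :> R.
    by rewrite ln_ge0 // ler1n; apply/card_gt0P; exists f0.
  set G := ln #|F|%:R / eta in ineq.
  have vA : v <= A + D%:R.
    rewrite ler_pdivrMr // mulrC -natrD -natrM ler_nat -sb.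
    exact: size_nonnull_le.
  have arith : (D * J)%:R + rho * (loss R M o R0 E f b + G) <=
      (c + eps) * (A - 2 * D%:R).
    apply: (@block_arith c eps `|alpha| rho _ G _ A D%:R v u) => //.
    - by apply: divr_ge0 => //; exact: ltW.
    - apply: (@regret_bound (ln #|F|%:R) _ _ eta B%:R n0%:R G s0 B0 eta0) => //.
      by have := lnF; rewrite natrM.
    - by rewrite natrM /u /v /n0 natrM; apply: switch_bound => //;
        apply: le_trans L0P _; rewrite ler_nat.
    apply: (offset_bound s0 e0 J0P).
    by rewrite ler_nat; apply: leq_trans n0J; rewrite ltnW // ltnS leq_addr.
  apply: (charge_bound qp _ arith); rewrite -/G natr1.
  by move: ineq; rewrite -mulnA [in X in X -> _]natrM.
exists {ffun n0.-bseq T -> F}, P.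
exists (fun s w => wrapper M o R0 L n0 s (expert E w)).
(* The constants stem from the two ends of the schedule in [opt_lower], the charge of the unfinished
   block, and the last term of [wrapper_cost]. *)
exists ((c + eps) * (2 * D%:R) + ((n0 * (q.+1 * (B * (2 * D)) + q * D))%:R + (2 * (q * D))%:R) / q%:R).
split=> [w||s w|s ts ss okss].
- exact: seedp_ge0.
- exact: seedp_sum1.
- split=> //; apply: wrapper_online => h; exact: onE.
have charge_le w : (charge M o D q R0 L (expert E w) (run M o n0 ts).2 <=
    n0 * (q.+1 * (B * (2 * D)) + q * D))%N.
  have [_ _ kn0] := run_inv M o n0_gt0 ts.
  apply: leq_trans (leq_mul (ltnW kn0) (leqnn _)).
  apply: hsum_le => h t; apply: leq_add; last by case: (L %| _)%N; rewrite ?muln1 ?muln0.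
  rewrite leq_mul2l; apply/orP; right; apply: leq_trans (ecost_le _ _ _ dD cD) _.
  by rewrite leq_mul2r size_rcons ltnS size_hammer orbT.
have [blocks _ _] := run_inv M o n0_gt0 ts.
have opt := opt_lower o n0 dD s o okss.
set bs := (run M o n0 ts).1 in blocks opt; set k := (run M o n0 ts).2 in opt charge_le.
have ech_bs : \sum_(b <- bs) ech b <=
    q%:R * ((c + eps) * ((npath M s ts ss)%:R + 2 * D%:R)).
  apply: (@le_trans _ _ (\sum_(b <- bs) q%:R * ((c + eps) * ((work M o b o)%:R - 2 * D%:R)))).
    rewrite big_seq [leRHS]big_seq; apply: ler_sum => b bbs.
    by apply: block; apply: (allP blocks).
  rewrite -!mulr_sumr ler_pM2l // ler_wpM2l ?addr_ge0 ?(ltW e0) //.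
  rewrite sumrB big_const_seq count_predT iter_addr_0 lerBlDr -natr_sum.
  have {}opt := leq_trans (leq_addr _ _) opt.
  have -> : (2 * D%:R) *+ size bs = (D * (2 * size bs))%:R :> R.
    by rewrite -mulr_natr !natrM; ring.
  rewrite -natrM -!natrD ler_nat; apply: leq_trans opt _.
  exact/addn_dist_le/dD.
have sumP (x : R) : \sum_w P w * x = x by rewrite -mulr_suml seedp_sum1 ?mul1r.
have echk : ech k <= (n0 * (q.+1 * (B * (2 * D)) + q * D))%:R.
  rewrite -echE -[leRHS]sumP; apply: ler_sum => w _.
  by apply: ler_wpM2l; [exact: seedp_ge0 | rewrite ler_nat].
rewrite -(ler_pM2l qp) mulrDr mulrDr mulrA [q%:R * (_ / _)]mulrCA mulfV ?mulr1 ?gt_eqF //.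
apply: (@le_trans _ _ (\sum_(b <- bs) ech b + ech k + (2 * (q * D))%:R)); last first.
  by move: ech_bs; rewrite !mulrDr; lra.
rewrite mulr_sumr.
(* By linearity of expectation, the same seed [w] can serve every block. *)
have -> : \sum_(b <- bs) ech b + ech k + (2 * (q * D))%:R =
  \sum_w P w * (\sum_(b <- bs) charge M o D q R0 L (expert E w) b +
     charge M o D q R0 L (expert E w) k + 2 * (q * D))%:R.
  under [RHS]eq_bigr do rewrite natrD3 !mulrDr natr_sum mulr_sumr.
  by rewrite !big_split /= sumP echE exchange_big.
apply: ler_sum => w _; rewrite mulrCA; apply: ler_wpM2l; first exact: seedp_ge0.
rewrite -natrM ler_nat.
by apply: wrapper_cost => // h; apply: onE.
Qed.

End Assembly.

(** * Advice strings as experts *)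

Section AdviceExec.
Variables (S T : finType) (A : advice_alg S T) (s0 : S).
Implicit Types (phi : nat -> bool) (ts : seq T) (ss : seq S).

(** Inversion with explicit equations, since the indices of [exec] involve [rcons] and addition. *)
Lemma exec_inv phi l ss k : exec A phi s0 l ss k ->
  [/\ l = [::], ss = [::] & k = 0%N] \/
  exists ts t ss1 s b j, [/\ l = rcons ts t, ss = rcons ss1 s, k = (b + j)%N,
    exec A phi s0 ts ss1 b & (forall i, (i < j)%N ->
      A s0 (rcons ts t) (tape_prefix phi (b + i)) = None) /\
      A s0 (rcons ts t) (tape_prefix phi (b + j)) = Some s].
Proof.
case=> [|ts ss1 b t j s ex none some]; [by left | right].
by exists ts, t, ss1, s, b, j.
Qed.

Lemma exec_size phi ts ss k : exec A phi s0 ts ss k -> size ss = size ts.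
Proof. by elim=> // *; rewrite !size_rcons; congr _.+1. Qed.

Lemma exec_det phi ts ss k ss' k' :
  exec A phi s0 ts ss k -> exec A phi s0 ts ss' k' -> ss = ss' /\ k = k'.
Proof.
move=> ex; elim: ex ss' k' => [ss' k'|ts1 ss1 b t j s ex1 IH none some ss' k'].
  by case/exec_inv => [[_ -> ->] //|[[|? ?] [? [? [? [? [? []]]]]]]].
case/exec_inv => [[e _ _]|]; first by case: (ts1) e.
case=> [ts2 [t2 [ss2 [s2 [b2 [j2 [e -> -> ex2 [none2 some2]]]]]]]].
case/rcons_inj: e => ? ?; subst ts2 t2.
have [? ?] := IH _ _ ex2; subst ss2 b2.
have jj : j = j2.
  case: (ltngtP j j2) => // [/none2|/none]; first by rewrite some.
  by rewrite some2.
by subst j2; move: some2; rewrite some => -[->].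
Qed.

(** A run queries only prefixes of length at most [k]; this lets a finite bit string replace the
    tape. *)
Lemma exec_tape phi phi' ts ss k : exec A phi s0 ts ss k ->
  (forall i, (i < k)%N -> phi i = phi' i) -> exec A phi' s0 ts ss k.
Proof.
elim=> [|ts1 ss1 b t j s ex IH none some] agree; first exact: exec_nil.
have pre i : (i <= j)%N -> tape_prefix phi' (b + i) = tape_prefix phi (b + i).
  move=> ij; apply/eq_in_map => m; rewrite mem_iota add0n => /andP[_ mb].
  by rewrite agree // (leq_trans mb) // leq_add2l.
apply: exec_step; last by rewrite pre.
  by apply: IH => i ib; apply: agree; rewrite ltn_addr.
by move=> i ij; rewrite pre ?none // ltnW.
Qed.

End AdviceExec.

Lemma outputs_rcons (S T : Type) (E : seq T -> S) ts t :
  [seq E (take i (rcons ts t)) | i <- iota 1 (size (rcons ts t))] =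
  rcons [seq E (take i ts) | i <- iota 1 (size ts)] (E (rcons ts t)).
Proof.
rewrite size_rcons -[(size ts).+1]addn1 iotaD map_cat cats1 /= add1n.
congr rcons; last by rewrite take_oversize // size_rcons.
apply/eq_in_map => i; rewrite mem_iota => /andP[_ ile].
by rewrite -cats1 takel_cat // -ltnS -add1n.
Qed.

Section AdviceExperts.
Variables (S T : finType) (M : nat_lts S T) (A : advice_alg S T) (o : S).

(** On a wrong bit string the algorithm may read forever or choose an infeasible state; the default
    of [xget] keeps the expert feasible. The string is padded with [false]. *)
Definition advice_expert (n : nat) (f : n.-tuple bool) (h : seq T) : S :=
  if h is t0 :: _ then
    xget (some_feas M (last t0 h))
      [set s | nfeas M (last t0 h) s /\
         exists ss k, exec A (nth false f) o h (rcons ss s) k]%classic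
  else o.

Lemma advice_expert_rcons n (f : n.-tuple bool) h t :
  advice_expert f (rcons h t) = xget (some_feas M t)
    [set s | nfeas M t s /\
       exists ss k, exec A (nth false f) o (rcons h t) (rcons ss s) k]%classic.
Proof.
rewrite /advice_expert; case E: (rcons h t) => [|t0 h0]; first by case: h E.
by have -> : last t0 (t0 :: h0) = t by rewrite -E last_rcons.
Qed.

Lemma advice_expert_online n (f : n.-tuple bool) : online M (advice_expert f).
Proof.
move=> h t; rewrite advice_expert_rcons.
by case: xgetP => [s _ []|_] //; apply: some_feasP.
Qed.

Lemma advice_expert_exec n (f : n.-tuple bool) ts ss k :
  exec A (nth false f) o ts ss k -> npath_ok M ts ss ->
  [seq advice_expert f (take i ts) | i <- iota 1 (size ts)] = ss.
Proof.
elim=> // ts1 ss1 b t j s ex IH none some.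
rewrite npath_ok_rcons ?(exec_size ex) // => /andP[oks okt].
rewrite outputs_rcons IH //; congr rcons.
rewrite advice_expert_rcons; case: xgetP => [s' _ [_ [ss' [k' ex']]]|].
  have [/rcons_inj[_ //]] := exec_det ex' (exec_step ex none some).
by move=> /(_ s) []; split=> //; exists ss1, (b + j)%N; apply: exec_step.
Qed.

Lemma advice_sublinear_experts (R : realType) (c alpha : R)
    (oracle : seq T -> nat -> bool) (b : nat -> nat) : sublinear R b ->
  (forall ts, exists ss k, [/\ exec A (oracle ts) o ts ss k,
     (k <= b (size ts))%N, npath_ok M ts ss & forall ss', npath_ok M ts ss' ->
     (npath M o ts ss)%:R <= c * (npath M o ts ss')%:R + alpha]) ->
  sublinear_experts M o c alpha.
Proof.
move=> bsub best delta delta0; have [N1 bN1] := bsub _ delta0.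
(* Beyond [N2], the finitely many values of [b] below [N1] are also at most [delta * N]. *)
have [N2 bN2] := natural_bound ((\max_(n < N1) b n)%:R / delta).
exists N2 => N N2N; pose bN := \max_(n < N.+1) b n.
have bNle : bN%:R <= delta * N%:R.
  rewrite /bN; elim/big_ind: _ => [|x y xle yle|n _].
  - by rewrite mulr_ge0 // ltW.
  - by case: (leqP x y).
  have [n1|n1] := leqP N1 n.
    by apply: le_trans (bN1 _ n1) _; rewrite ler_pM2l // ler_nat -ltnS.
  apply: (@le_trans _ _ (\max_(n < N1) b n)%:R).
    by rewrite ler_nat (@leq_bigmax _ (fun i : 'I_N1 => b i) (Ordinal n1)).
  by rewrite -ler_pdivrMl // mulrC (le_trans bN2) // ler_nat.
exists (bN.-tuple bool : finType), (@advice_expert bN); split.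
- exact: advice_expert_online.
- rewrite card_tuple card_bool natrX lnXn ?ltr0n //.
  apply: le_trans bNle; rewrite -[leLHS]mulr_natl -[leRHS]mulr1 ler_wpM2l //.
  by apply: (@le_ln1Dx R 1); lra.
move=> ts tsN; have [ss [k [ex kb okss ssbest]]] := best ts.
have kbN : (k <= bN)%N.
  apply: leq_trans kb _.
  exact: (@leq_bigmax _ (fun i : 'I_N.+1 => b i) (Ordinal (tsN : _ < N.+1)%N)).
exists (mktuple (fun i => oracle ts i)) => ss' okss'.
set f := mktuple _.
have exf : exec A (nth false f) o ts ss k.
  apply: (exec_tape ex) => i ik; have ibN := leq_trans ik kbN.
  by rewrite (_ : i = Ordinal ibN) // -tnth_nth tnth_mktuple.
by rewrite ecost_npath /= (advice_expert_exec exf) //; apply: ssbest.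
Qed.

End AdviceExperts.

(** * Rounding the costs *)

Section Rounding.
Variables (R : realType) (g : R).
Hypothesis g0 : 0 < g.

Definition round_up (x : R) : nat := `|Num.ceil (x / g)|%N.

Lemma round_up_itv x : 0 <= x -> x <= g * (round_up x)%:R < x + g.
Proof.
move=> x0; have c0 : 0 <= Num.ceil (x / g).
  by rewrite ceil_ge0 (lt_le_trans (ltrN10 R)) // divr_ge0 // ltW.
have -> : (round_up x)%:R = (Num.ceil (x / g))%:~R :> R.
  by rewrite /round_up natr_absz ger0_norm.
have /andP[lo hi] := ceil_itv (x / g).
apply/andP; split; first by rewrite -ler_pdivrMl // mulrC.
rewrite -ltr_pdivlMl // mulrDr mulVf ?gt_eqF // [g^-1 * x]mulrC -ltrBlDr.
by move: lo; rewrite intrB.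
Qed.

Lemma round_up_le x n : 0 <= x -> x <= g * n%:R -> (round_up x <= n)%N.
Proof.
move=> x0 xn; have /andP[_ hi] := round_up_itv x0.
rewrite -ltnS -(ltr_nat R) -(ltr_pM2l g0); apply: lt_le_trans hi _.
by rewrite -natr1 mulrDr mulr1 lerD2r.
Qed.

Lemma round_up_gt0 x : 0 < x -> (0 < round_up x)%N.
Proof.
move=> x0; have /andP[lo _] := round_up_itv (ltW x0).
by rewrite -(ltr_nat R) -(ltr_pM2l g0) mulr0 (lt_le_trans x0).
Qed.

(** The sum of the roundings of [y] and [z] is a multiple of [g] above [x], and [round_up] is the
    least one. *)
Lemma round_upD x y z : 0 <= x -> 0 <= y -> 0 <= z -> x <= y + z ->
  (round_up x <= round_up y + round_up z)%N.
Proof.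
move=> x0 y0 z0 xyz; apply: round_up_le => //.
have /andP[ylo _] := round_up_itv y0; have /andP[zlo _] := round_up_itv z0.
by rewrite natrD mulrDr; apply: le_trans xyz _; apply: lerD.
Qed.

Lemma round_up_approx e x : 0 <= x -> (0 < x -> g <= e * x) ->
  x <= g * (round_up x)%:R <= (1 + e) * x.
Proof.
move=> x0 gx; have /andP[lo hi] := round_up_itv x0; rewrite lo /=.
move: x0; rewrite le_eqVlt => /predU1P[<-|/gx xg]; last by lra.
by rewrite mulr0 /round_up mul0r ceil0 mulr0.
Qed.

End Rounding.

Lemma pos_lower_bound (R : realType) (I : finType) (F : I -> R) :
  exists2 m : R, 0 < m & forall i, 0 < F i -> m <= F i.
Proof.
exists (\big[Order.min/1]_(i | 0 < F i) F i) => [|i Fi]; last exact: bigmin_le_cond.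
by elim/big_ind: _ => // x y x0 y0; rewrite lt_min x0.
Qed.

Section Discretization.
Variables (R : realType) (S T : finType) (tv : T -> S -> \bar R) (d : S -> S -> R).
Hypothesis hLTS : lazy_task_system tv d.

(** [g] is [e] times a lower bound on all positive costs; [fine] sends infinite values to 0, so they
    impose nothing. *)
Lemma scale_exists (e : R) : 0 < e -> exists g : R, [/\ 0 < g,
  forall s s', 0 < d s s' -> g <= e * d s s' &
  forall t s, 0 < fine (tv t s) -> g <= e * fine (tv t s)].
Proof.
move=> e0.
have [m1 m10 H1] := pos_lower_bound (fun p : S * S => d p.1 p.2).
have [m2 m20 H2] := pos_lower_bound (fun p : T * S => fine (tv p.1 p.2)).
exists (e * Order.min m1 m2); split=> [|s s' h|t s h].
- by rewrite mulr_gt0 // lt_min m10.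
- by rewrite ler_pM2l // ge_min (H1 (s, s') h).
- by rewrite ler_pM2l // ge_min (H2 (t, s) h) orbT.
Qed.

Variables (g : R) (g0 : 0 < g).

Lemma feas_ex t : exists s, (tv t s < +oo)%E.
Proof. by case: hLTS => _ /(_ t). Qed.

Lemma round_tri x y z :
  (round_up g (d x z) <= round_up g (d x y) + round_up g (d y z))%N.
Proof. by case: hLTS => _ _ dge0 _ tri; apply: round_upD. Qed.

Lemma round_dist_gt0 x y : x != y -> (0 < round_up g (d x y))%N.
Proof. by case: hLTS => _ _ _ dpos _ /dpos; apply: round_up_gt0. Qed.

Definition discretize : nat_lts S T :=
  NatLTS (fun t s => round_up g (fine (tv t s))) feas_ex round_tri round_dist_gt0.

Variable e : R.
Hypothesis ge_d : forall s s', 0 < d s s' -> g <= e * d s s'.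
Hypothesis ge_t : forall t s, 0 < fine (tv t s) -> g <= e * fine (tv t s).

Lemma path_cost_approx s ts ss : npath_ok discretize ts ss ->
  exists2 r : R, path_cost tv d s ts ss = r%:E &
    0 <= r <= g * (npath discretize s ts ss)%:R /\
    g * (npath discretize s ts ss)%:R <= (1 + e) * r.
Proof.
case: hLTS => tge0 _ dge0 _ _.
elim: ts s ss => [|t ts IH] s [|s' ss] //=; first by exists 0; rewrite ?mulr0 ?lexx.
case/andP => okt /(IH s')[r -> [/andP[r0 lo] hi]].
have tfin : tv t s' \is a fin_num by rewrite ge0_fin_numE.
exists (d s s' + fine (tv t s') + r); first by rewrite !EFinD fineK.
have f0 : 0 <= fine (tv t s') by apply: fine_ge0.
have /andP[dl dh] := round_up_approx g0 (dge0 s s') (@ge_d s s').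
have /andP[tl th] := round_up_approx g0 f0 (@ge_t t s').
have ds := dge0 s s'.
rewrite !natrD !mulrDr; split; last by lra.
by apply/andP; split; [rewrite !addr_ge0 | lra].
Qed.

Lemma path_cost_ge0 s ts ss : (0 <= path_cost tv d s ts ss)%E.
Proof.
case: hLTS => tge0 _ dge0 _ _; elim: ts s ss => [|t ts IH] s [|s' ss] //=.
by rewrite !adde_ge0 ?lee_fin.
Qed.

Lemma path_cost_fin s ts ss : size ss = size ts ->
  (path_cost tv d s ts ss < +oo)%E -> npath_ok discretize ts ss.
Proof.
case: hLTS => tge0 _ dge0 _ _; elim: ts s ss => [|t ts IH] s [|s' ss] //= [sz].
move=> fin; apply/andP; split; last first.
  apply: (IH s') => //; apply: le_lt_trans fin.
  by rewrite leeDr // adde_ge0 ?lee_fin.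
apply: le_lt_trans fin; rewrite -addeA [leRHS]addeCA leeDl //.
by rewrite adde_ge0 ?lee_fin ?path_cost_ge0.
Qed.

Lemma OPT_le s ts ss : size ss = size ts ->
  (OPT tv d s ts <= path_cost tv d s ts ss)%E.
Proof. by move=> sz; apply: ereal_inf_lbound; exists ss. Qed.

Lemma feas_path ts : exists ss, npath_ok discretize ts ss.
Proof.
elim: ts => [|t ts [ss ok]]; first by exists [::].
exists (some_feas discretize t :: ss).
by apply/andP; split; [apply: (some_feasP discretize) | exact: ok].
Qed.

End Discretization.

(** * Finite distributions as probability measures on [nat] *)

Section FiniteProbability.
Variables (R : realType) (W : finType) (P : W -> R).
Hypotheses (P_ge0 : forall w, 0 <= P w) (P_sum1 : \sum_w P w = 1).
Variable w0 : W.

Definition nat_elt (i : nat) : W := nth w0 (enum W) i.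

(** A sum of weighted Dirac masses on indices; every subset of [nat] is measurable, so measurability
    of the cost is immediate. *)
Definition finite_prob : set nat -> \bar R :=
  msum (fun i => mscale (NngNum (P_ge0 (nat_elt i))) \d_i) #|W|.

HB.instance Definition _ := Measure.on finite_prob.

Lemma sum_nat_elt (V : nmodType) (F : W -> V) :
  \sum_(i < #|W|) F (nat_elt i) = \sum_w F w.
Proof. by rewrite -[RHS]big_enum (big_nth w0) big_mkord -cardE. Qed.

Lemma finite_measure_setT : finite_prob setT = 1%E.
Proof.
rewrite /finite_prob /= /msum /= /mscale /=.
under eq_bigr do rewrite diracT mule1.
by rewrite sumEFin sum_nat_elt P_sum1.
Qed.

HB.instance Definition _ := @Measure_isProbability.Build _ _ R
  finite_prob finite_measure_setT.

Definition finite_probability : probability nat R := finite_prob.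

Lemma integral_finite (f : W -> \bar R) : (forall w, 0 <= f w)%E ->
  (\int[finite_probability]_i f (nat_elt i) = \sum_w (P w)%:E * f w)%E.
Proof.
move=> f0; rewrite ge0_integral_measure_sum //=.
under eq_bigr do rewrite ge0_integral_mscale //= integral_dirac //= diracT mul1e.
exact: (sum_nat_elt (fun w => (P w)%:E * f w)%E).
Qed.

End FiniteProbability.

(** * Transfer to the original costs *)

(** Rounding enters twice, once in the experts' guarantee and once in the comparison schedule. *)
Lemma slack_factor (R : realType) (c e eps r : R) : 1 <= c -> 0 <= e <= 1 ->
  8 * (c * e) <= eps -> 0 <= r ->
  ((1 + e) * c + eps / 4) * ((1 + e) * r) <= (c + eps) * r.
Proof.
move=> c1 /andP[e0 e1] ce r0; rewrite mulrA ler_wpM2r //.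
have : 0 <= c * e by rewrite mulr_ge0 //; lra.
have : c * e * e <= c * e by rewrite ler_piMr // mulr_ge0 //; lra.
have : eps * e <= eps by rewrite ler_piMr //; nra.
have -> : ((1 + e) * c + eps / 4) * (1 + e) =
  c + 2 * (c * e) + c * e * e + eps / 4 + eps * e / 4 by field.
by lra.
Qed.

Theorem theorem7 (R : realType) (S T : finType) (tv : T -> S -> \bar R)
    (d : S -> S -> R) (hLTS : lazy_task_system tv d)
    (c : R) (hc : 1 <= c) (ALG : advice_alg S T)
    (hALG : advice_competitive_sublinear tv d ALG c) :
  forall eps : R, 0 < eps -> randomized_competitive tv d (c + eps).
Proof.
move=> eps eps0; have [oracle [b [alpha [bsub best]]]] := hALG.
case: (pickP (fun _ : S => true)) => [ o _ | noS ]; last first.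
  exists _, nat, (\d_(0%N) : probability _ R), (fun _ s _ => s).
  by split=> [_ s|s|]; [have := noS s | have := noS s | exists 0 => s; have := noS s].
have c0 : 0 < c by exact: lt_le_trans hc.
pose e := Order.min 1 (eps / (8 * c)).
have e0 : 0 < e by rewrite lt_min ltr01 divr_gt0 // mulr_gt0.
have e1 : e <= 1 by rewrite ge_min lexx.
have ce : 8 * (c * e) <= eps.
  by rewrite mulrA mulrC -ler_pdivlMr ?mulr_gt0 // ge_min lexx orbT.
have [g [g0 ge_d ge_t]] := scale_exists tv d e0.
pose M := discretize hLTS g0.
have approx s ts ss := @path_cost_approx _ _ _ _ _ hLTS _ g0 _ ge_d ge_t s ts ss.
have experts : sublinear_experts M o ((1 + e) * c) ((1 + e) * `|alpha| / g).
  apply: (@advice_sublinear_experts _ _ _ ALG _ _ _ _ (oracle o) b bsub) => ts.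
  have [ss [k [ex kb cost]]] := best o ts; exists ss, k.
  have bound ss' : npath_ok M ts ss' ->
      (path_cost tv d o ts ss <= (c * (g * (npath M o ts ss')%:R) + `|alpha|)%:E)%E.
    move=> ok'; apply: (le_trans cost).
    have [r' rE [/andP[r0 rg] _]] := approx o _ _ ok'.
    rewrite EFinD; apply: leeD; last by rewrite lee_fin ler_norm.
    rewrite EFinM; apply: lee_wpmul2l; first by rewrite lee_fin ltW.
    by apply: le_trans (@OPT_le _ _ _ tv d o ts ss' (npath_ok_size ok')) _; rewrite rE lee_fin.
  (* Some feasible schedule exists, so the competitive bound is finite and the advised run must be
     feasible. *)
  have okss : npath_ok M ts ss.
    have [ss' ok'] := feas_path hLTS g0 ts.
    apply: (@path_cost_fin _ _ _ _ _ _ _ _ o); first exact: exec_size ex.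
    by apply: le_lt_trans (bound _ ok') _; rewrite ltry.
  split=> // ss' ok'; have := bound _ ok'.
  have [r rE [/andP[r0 rg] gr]] := approx o _ _ okss.
  rewrite rE lee_fin => rle; rewrite -(ler_pM2l g0); apply: (le_trans gr).
  have -> : g * ((1 + e) * c * (npath M o ts ss')%:R + (1 + e) * `|alpha| / g) =
    (1 + e) * (c * (g * (npath M o ts ss')%:R) + `|alpha|).
    by field; rewrite gt_eqF.
  by rewrite ler_wpM2l // addr_ge0 // ltW.
have [||W [P [A [beta [P0 P1 onA Acost]]]]] := nat_randomized _ experts (eps := eps / 4).
- by rewrite mulr_ge0 ?addr_ge0 // ltW.
- by rewrite divr_gt0.
have [w0 _|noW] := pickP (fun _ : W => true); last first.
  by move: P1; rewrite big_pred0 // => /eqP; rewrite eq_sym oner_eq0.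
have okA s w ts := online_npath_ok [::] ts (onA s w).1.
have costA s w ts : exists2 r, det_cost tv d (A^~ w) s ts = r%:E &
    0 <= r <= g * (ecost M (A s w) [::] ts)%:R.
  have [r rE [rb _]] := approx s _ _ (okA s w ts); exists r; first exact: rE.
  by rewrite ecost_npath (onA s w).2.
exists _, nat, (finite_probability P0 P1 w0), (fun i s h => A s (nat_elt w0 i) h).
split=> [i s ts t|//|]; first exact: (onA s (nat_elt w0 i)).1.
exists (g * beta) => s ts.
have cost0 w : (0 <= det_cost tv d (A^~ w) s ts)%E.
  by have [r -> /andP[]] := costA s w ts; rewrite lee_fin.
rewrite (integral_finite P0 P1 w0 cost0).
pose Q : R := g * \sum_w P w * (ecost M (A s w) [::] ts)%:R.
apply: (@le_trans _ _ Q%:E).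
  rewrite /Q mulr_sumr -sumEFin; apply: lee_sum => w _.
  have [r -> /andP[r0 rle]] := costA s w ts.
  by rewrite -EFinM lee_fin mulrCA ler_wpM2l.
have K0 : 0 < c + eps by rewrite addr_gt0.
(* [OPT] is an infimum in the extended reals; solving the inequality for it leaves a real lower
   bound to check on each schedule. *)
have Kle : (((Q - g * beta) / (c + eps))%:E <= OPT tv d s ts)%E.
  apply: le_ereal_inf_tmp => _ [ss sz <-].
  have [fin|] := ltP (path_cost tv d s ts ss) +oo%E; last by move/(le_trans _); apply; rewrite leey.
  have okss := path_cost_fin hLTS g0 sz fin.
  have [r -> [/andP[r0 _] gr]] := approx s ts ss okss.
  rewrite lee_fin ler_pdivrMr // [r * _]mulrC lerBlDr.
  have := Acost s ts ss okss; rewrite -(ler_pM2l g0) => /le_trans; apply.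
  rewrite mulrDr lerD2r; apply: le_trans (slack_factor hc _ ce r0); last by rewrite ltW.
  by rewrite mulrCA ler_wpM2l // addr_ge0 ?divr_ge0 ?mulr_ge0 ?addr_ge0 ?ltW.
have := lee_wpmul2l (_ : 0 <= (c + eps)%:E)%E Kle; rewrite lee_fin ltW // => /(_ isT).
rewrite -EFinM mulrCA mulfV ?gt_eqF // mulr1 => /(leeD2r (g * beta)%:E).
by rewrite -EFinD subrK.
Qed.
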